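(* Suppose that $X\in\mathbb{R}^{n\times n}$ is symmetric with $X\succeq0$ and $\|\mathrm{diag}(X)-\mathbf{1}_n\|_1\le\delta$. Then there exists $X'\succeq0$ with $\mathrm{diag}(X')=\mathbf{1}_n$ such that for any symmetric $A\in\mathbb{R}^{n\times n}$, $$\mathrm{Tr}[A(X-X')]\le3\delta\|A\|_\infty.$$
   Context: $\|A\|_\infty=\max_j\sum_i|A_{ij}|$. $\mathrm{diag}(X)$ is the vector of diagonal entries of $X$; $\mathbf{1}_n$ is the all-ones vector. *)

(* Defs.v *)
From HB Require Import structures.
From mathcomp Require Import all_boot all_order all_algebra.
From mathcomp Require Import reals.

Set Implicit Arguments.
Unset Strict Implicit.
Unset Printing Implicit Defensive.

Import Order.TTheory GRing.Theory Num.Theory.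
Local Open Scope ring_scope.

(* The Loewner order is on symmetric matrices, so symmetry is part of the notion. *)
Definition psdmx (R : realType) (n : nat) (X : 'M[R]_n) : Prop :=
  X \is symmetricmx /\ forall v : 'cV[R]_n, 0 <= (v^T *m X *m v) 0 0.

Definition diag_vec (R : realType) (n : nat) (X : 'M[R]_n) : 'rV[R]_n :=
  \row_i X i i.

Definition l1norm (R : realType) (n : nat) (u : 'rV[R]_n) : R :=
  \sum_(i < n) `|u 0 i|.

(* The maximum is over columns j of the absolute column sums. Seeding it with 0
   is harmless as the sums are nonnegative; it gives the value 0 when n = 0. *)
Definition norm_infty (R : realType) (n : nat) (A : 'M[R]_n) : R :=
  \big[Num.max/0]_(j < n) \sum_(i < n) `|A i j|.

(* Main.v *)
(** Rescale X by the factors 1/m_i with m_i = sqrt (max 1 X_ii), then restore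
    the diagonal to 1 by adding a nonnegative diagonal matrix.  Entries of the
    result X' are at most 1 in absolute value, so off the diagonal
    |X_ij - X'_ij| <= m_i m_j - 1, which by AM-GM is at most the mean of
    |X_ii - 1| and |X_jj - 1|. *)
Require Import Defs.
From HB Require Import structures.
From mathcomp Require Import all_boot all_order all_algebra.
From mathcomp Require Import reals.
From mathcomp Require Import lra ring.

Import Order.TTheory GRing.Theory Num.Theory.
Local Open Scope ring_scope.

Lemma symmetricmxP (R : realType) (n : nat) (X : 'M[R]_n) :
  reflect (X^T = X) (X \is symmetricmx).
Proof.
by apply: (iffP (is_hermitianmxP _ _ _)); rewrite expr0 scale1r map_mx_id.
Qed.

Lemma psdmxD (R : realType) (n : nat) (X Y : 'M[R]_n) :
  psdmx X -> psdmx Y -> psdmx (X + Y).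
Proof.
move=> [/symmetricmxP Xs Xp] [/symmetricmxP Ys Yp]; split.
  by apply/symmetricmxP; rewrite linearD /= Xs Ys.
by move=> v; rewrite mulmxDr mulmxDl mxE addr_ge0.
Qed.

Lemma psdmx_congr (R : realType) (m n : nat) (X : 'M[R]_m) (B : 'M[R]_(m, n)) :
  psdmx X -> psdmx (B^T *m X *m B).
Proof.
move=> [/symmetricmxP Xs Xp]; split.
  by apply/symmetricmxP; rewrite !trmx_mul trmxK Xs mulmxA.
by move=> v; have := Xp (B *m v); rewrite trmx_mul !mulmxA.
Qed.

Lemma psdmx_diag (R : realType) (n : nat) (w : 'rV[R]_n) :
  (forall i, 0 <= w 0 i) -> psdmx (diag_mx w).
Proof.
move=> w_ge0; split.
  by apply/symmetricmxP; rewrite tr_diag_mx.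
move=> v; rewrite -mulmxA mul_diag_mx !mxE sumr_ge0 // => i _.
by rewrite !mxE mulrCA mulr_ge0 // -expr2 sqr_ge0.
Qed.

(** Evaluate the quadratic form at the sum and at the difference of the basis vectors of indices [i]
    and [j]. For a unit diagonal this confines every entry to the interval from -1 to 1. *)
Lemma psdmx_entry_le (R : realType) (n : nat) (X : 'M[R]_n) i j :
  psdmx X -> 2 * `|X i j| <= X i i + X j j.
Proof.
move=> [/symmetricmxP Xs Xp].
have Xji : X j i = X i j by rewrite -[in LHS]Xs mxE.
have quad (c : R) : 0 <= X i i + c * (X i j *+ 2) + c ^+ 2 * X j j.
  have := Xp (delta_mx i 0 + c *: delta_mx j 0).
  rewrite [(_ + _)^T]linearD /= [(_ *: _)^T]linearZ /= !trmx_delta !(mulmxDl, mulmxDr).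
  rewrite -!scalemxAl -!scalemxAr -!rowE -!colE !mxE.
  by rewrite Xji; congr (0 <= _); ring.
have := quad 1; have := quad (-1).
by case: (ger0P (X i j)) => *; lra.
Qed.

Lemma norm_infty_col_le (R : realType) (n : nat) (A : 'M[R]_n) j :
  \sum_i `|A i j| <= norm_infty A.
Proof. exact: (le_bigmax 0 (fun j => \sum_i `|A i j|)). Qed.

(** Twice the trace is at most the sum of [|A i j| * (|e i| + |e j|)]. The [e j] half groups by
    columns of [A], each of absolute sum at most [norm_infty A]; symmetry of [A] reduces the [e i]
    half to the same bound. *)
Lemma mxtrace_mul_le (R : realType) (n : nat) (A D : 'M[R]_n) (e : 'rV[R]_n) :
    A \is symmetricmx ->
    (forall i j, 2 * `|D i j| <= `|e 0 i| + `|e 0 j|) ->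
  \tr (A *m D) <= l1norm e * norm_infty A.
Proof.
move=> /symmetricmxP As De.
have weighted : \sum_i \sum_j `|A i j| * `|e 0 j| <= l1norm e * norm_infty A.
  rewrite exchange_big mulr_suml ler_sum // => j _.
  by rewrite -mulr_suml mulrC ler_wpM2l // norm_infty_col_le.
have weightedT : \sum_i \sum_j `|A i j| * `|e 0 i| <= l1norm e * norm_infty A.
  rewrite exchange_big; apply: (le_trans _ weighted).
  apply: ler_sum => i _; apply: ler_sum => j _.
  by rewrite -[in leLHS]As mxE.
rewrite -(ler_pM2l (ltr0n R 2)).
rewrite [leRHS]mulr_natl [leRHS]mulr2n.
apply: (le_trans _ (lerD weightedT weighted)).
rewrite -big_split mulr_sumr ler_sum // => i _.
rewrite mxE -big_split mulr_sumr ler_sum // => j _ /=.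
apply: (le_trans (ler_norm _)).
by rewrite !normrM -mulrDr (ger0_norm (ler0n _ 2)) mulrCA ler_wpM2l // addrC.
Qed.

Theorem lemma27 (R : realType) (n : nat) (X : 'M[R]_n) (delta : R)
    (X_sym : X \is symmetricmx)
    (X_psd : psdmx X)
    (X_diag : l1norm (diag_vec X - const_mx 1) <= delta) :
  exists X' : 'M[R]_n,
    [/\ psdmx X',
        diag_vec X' = const_mx 1
      & forall A : 'M[R]_n, A \is symmetricmx ->
          \tr (A *m (X - X')) <= 3%:R * delta * norm_infty A].
Proof.
pose m i : R := Num.sqrt (Num.max 1 (X i i)).
have m2 i : m i ^+ 2 = Num.max 1 (X i i).
  by rewrite sqr_sqrtr // le_max ler01.
have m_gt0 i : 0 < m i by rewrite sqrtr_gt0 lt_max ltr01.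
have m_ge1 i : 1 <= m i.
  by rewrite -[leLHS]sqrtr1 ler_wsqrtr // le_max lexx.
pose s := \row_i (m i)^-1; pose w := \row_i (1 - X i i / m i ^+ 2).
pose X' := (diag_mx s)^T *m X *m diag_mx s + diag_mx w.
have X'E i j : X' i j = X i j / (m i * m j) + (1 - X i i / m i ^+ 2) *+ (i == j).
  rewrite /X' tr_diag_mx mul_diag_mx mul_mx_diag !mxE.
  by congr (_ + _); rewrite invfM mulrA [_ * X i j]mulrC.
have X'ii i : X' i i = 1 by rewrite X'E eqxx mulr1n -expr2 addrC subrK.
have X'_psd : psdmx X'.
  apply: psdmxD; first exact: psdmx_congr.
  (* The diagonal correction is nonnegative because [m i ^+ 2] dominates [X i i]. *)
  apply: psdmx_diag => i; rewrite mxE subr_ge0 ler_pdivrMr ?exprn_gt0 //.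
  by rewrite mul1r m2 le_max lexx orbT.
exists X'; split=> // [|A A_sym].
  by apply/rowP => i; rewrite mxE X'ii mxE.
pose e := diag_vec X - const_mx 1.
(* The left side is the positive part of [X i i - 1]. *)
have m2_le i : m i ^+ 2 - 1 <= `|e 0 i|.
  rewrite !mxE m2; case: (leP 1 (X i i)) => _; first exact: ler_norm.
  by rewrite subrr.
have subE i j : (X - X') i j = X i j - X' i j.
  by rewrite mxE; congr (_ + _); rewrite mxE.
have entry_le i j : 2 * `|(X - X') i j| <= `|e 0 i| + `|e 0 j|.
  have [<-|ij] := eqVneq i j.
    by rewrite subE X'ii !mxE; lra.
  have X'_le := psdmx_entry_le _ _ _ i j X'_psd.
  have mm_ge1 : 1 <= m i * m j by rewrite mulr_ege1.
  (* Off the diagonal only the rescaling acts, so [X i j = m i * m j * X' i j]. *)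
  have -> : (X - X') i j = X' i j * (m i * m j - 1).
    by rewrite subE X'E (negPf ij) addr0; field; rewrite !gt_eqF.
  rewrite normrM (ger0_norm (_ : 0 <= m i * m j - 1)) ?subr_ge0 //.
  have X'1 : `|X' i j| <= 1 by move: X'_le; rewrite !X'ii; lra.
  have := ler_wpM2r (_ : 0 <= m i * m j - 1) X'1.
  rewrite subr_ge0 => /(_ mm_ge1).
  (* AM-GM gives [2 * (m i * m j - 1) <= (m i ^+ 2 - 1) + (m j ^+ 2 - 1)]. *)
  have := sqr_ge0 (m i - m j); have := m2_le i; have := m2_le j; nra.
have e_ge0 : 0 <= l1norm e by apply: sumr_ge0.
have A_ge0 : 0 <= norm_infty A by apply: bigmax_ge_id.
apply: le_trans (mxtrace_mul_le _ _ _ _ _ A_sym entry_le) _.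
(* The trace bound has constant 1; since [0 <= l1norm e <= delta], it relaxes to [3 * delta]. *)
apply: ler_wpM2r => //; have := le_trans e_ge0 X_diag.
by move: X_diag; rewrite -/e; lra.
Qed.
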